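(* For every integer $t\geq 5$ and every positive integer $k$, \[ \mathrm{LCS}_2(t,\mathcal{P}_k)\geq\left(\tfrac{7}{4}-\tfrac{8}{t}\right)^{1/6}k^{1/3}-2. \]
   Context: $\mathcal{P}_k$ is the set of permutations on $k$ letters, viewed as words over $\{1,\dots,k\}$ in which each letter occurs exactly once. $\mathrm{LCS}(w,w')$ is the length of a longest common subsequence of words $w,w'$. $\mathrm{LCS}_2(t,\mathcal P_k)$ is the minimum, over all sets of $t$ distinct permutations in $\mathcal P_k$, of the maximum of $\mathrm{LCS}(\pi,\pi')$ over pairs of distinct $\pi,\pi'$ in the set. *)

(* Defs.v *)
From mathcomp Require Import all_boot all_fingroup.
Set Implicit Arguments. Unset Strict Implicit. Unset Printing Implicit Defensive.

Definition perm_word (k : nat) (p : {perm 'I_k}) : seq 'I_k :=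
  [seq p i | i <- enum 'I_k].

Definition lcs (T : eqType) (s t : seq T) : nat :=
  \max_(m : (size s).-tuple bool | subseq (mask m s) t) size (mask m s).

Definition max_pair_lcs (k : nat) (S : {set {perm 'I_k}}) : nat :=
  \max_(p in S) \max_(q in S | p != q) lcs (perm_word p) (perm_word q).

(* Main.v *)
(** For permutations [p], [q] let [level p q a] be the length of a longest common
    subsequence ending at [a]. Of three permutations two always order [a] and [b]
    alike, so for distinct [p], [q], [r] the three levels determine the letter, and
    the pairs [(a, b)] that are weakly comparable in all three levels number at most
    [((L+1)(L+2)/2)^3], where [L] is the largest LCS.

    Conversely fix [a] and [b], and colour the edge [pq] red if
    [level p q a <= level p q b] and blue otherwise. The permutations placing [a]
    before [b] form a red clique and the others a blue clique. In a two-colouring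
    that extends such a pair of cliques, asymptotically at least [7/16] of the
    triangles are monochromatic (Goodman's count of two-coloured angles), not just
    [1/4]; a monochromatic triangle is a comparable triple. Double counting over all
    pairs of letters gives [(7/4 - 8/t) k^2 <= (L+2)^6]. *)

Require Import Defs.
From mathcomp Require Import all_boot all_fingroup.
From mathcomp Require Import zify.

Set Implicit Arguments. Unset Strict Implicit. Unset Printing Implicit Defensive.

(** * Arithmetic of the triangle count *)

(** In the application [D] sums the products of odd and even degrees, [m] the odd degrees and [s2]
    their squares. The bound [D <= (t-1)m - m^2/t] increases in [m] up to [t(t-1)/2 >= t^2/4], so
    [m = t^2/4] is the extremal case. *)
Lemma mono_triangles_lower_bound t M D m s2 : 1 < t -> D + s2 = t.-1 * m -> m ^ 2 <= t * s2 ->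
  M + 3 * D = t * t.-1 * t.-2 -> 4 * m <= t ^ 2 ->
  7 * t ^ 3 + 32 * t <= 16 * M + 36 * t ^ 2.
Proof.
case: t => [|[|t]] //= _.
rewrite !expnS !expn0 !muln1 => mD cs total m_le.
have h : t.+2 * D + m * m <= t.+2 * (t.+1 * m) by rewrite -mD mulnDr leq_add2l.
have key : 16 * D + 4 * (t.+2 * t.+2) <= 3 * (t.+2 * (t.+2 * t.+2)).
  rewrite -(leq_pmul2l (m := t.+2)) //.
  (* With [n = t.+2], the slack [d] leaves a surplus of at least [2n(n-2)d + d^2], which is
     nonnegative. *)
  have [d dE] : exists d, t.+2 * t.+2 = 4 * m + d by exists (t.+2 * t.+2 - 4 * m); lia.
  have e1 : 16 * (m * m) + 2 * (t.+2 * t.+2 * d) = t.+2 * t.+2 * (t.+2 * t.+2) + d * d.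
    by rewrite dE; lia.
  have e2 : 16 * (t.+2 * (t.+1 * m)) + 4 * (t.+2 * (t.+1 * d)) =
            4 * (t.+2 * (t.+1 * (t.+2 * t.+2))).
    by rewrite dE; lia.
  lia.
lia.
Qed.

(** * Monochromatic triangles in a two-colouring with two prescribed cliques *)

Section Triangles.
Variables (V : finType) (S : {set V}).

Definition triple_count (P : V -> V -> V -> bool) : nat :=
  \sum_(p in S) \sum_(q in S) \sum_(r in S) P p q r.

Definition distinct3 (p q r : V) : bool := [&& p != q, p != r & q != r].

Lemma triple_count_swap12 P :
  triple_count (fun p q r => P q p r) = triple_count P.
Proof. by rewrite /triple_count exchange_big. Qed.

Lemma triple_count_rot3 P :
  triple_count (fun p q r => P r p q) = triple_count P.
Proof.
rewrite /triple_count.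
under eq_bigr => p _ do rewrite exchange_big.
by rewrite exchange_big.
Qed.

Lemma sum_neq p : p \in S -> \sum_(q in S) (p != q : nat) = #|S|.-1.
Proof.
move=> pS; rewrite -big_mkcondr sum1_card (cardsD1 p S) pS add1n /=.
by apply: eq_card => q; rewrite !inE unfold_in eq_sym andbC.
Qed.

Lemma triple_count_distinct3 :
  triple_count distinct3 = #|S| * #|S|.-1 * #|S|.-2.
Proof.
rewrite /triple_count -mulnA -sum_nat_const; apply: eq_bigr => p pS.
set d := #|S|.-2; rewrite -(sum_neq pS) big_distrl /=; apply: eq_bigr => q qS.
rewrite /distinct3; case: (eqVneq p q) => /= [_|npq].
  by rewrite big1 // mul0n.
rewrite mul1n /d -big_mkcondr sum1_card (cardsD1 p S) pS add1n /=.
rewrite (cardsD1 q (S :\ p)) !inE eq_sym npq qS add1n /=.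
apply: eq_card => r; rewrite !inE unfold_in (eq_sym p) (eq_sym q).
by case: (r \in S) (r == p) (r == q) => [] [] [].
Qed.

Variables (g : rel V) (A : {set V}).
Hypothesis g_sym : symmetric g.
Hypothesis g_in : {in S &, forall p q, p != q -> p \in A -> q \in A -> g p q}.
Hypothesis g_out :
  {in S &, forall p q, p != q -> p \notin A -> q \notin A -> ~~ g p q}.

Definition mono3 (p q r : V) : bool := (g p q == g p r) && (g p q == g q r).

(* An edge is odd at [p] if it does not have the colour of the clique of [p]; thus
   an edge between the two cliques is odd at exactly one of its endpoints. *)
Let odd_edge p q : bool := (p != q) && (g p q != (p \in A)).
Let even_edge p q : bool := (p != q) && (g p q == (p \in A)).
Let odd_degree p : nat := \sum_(q in S) odd_edge p q.
Let even_degree p : nat := \sum_(q in S) even_edge p q.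

Lemma odd_even_degree p : p \in S -> odd_degree p + even_degree p = #|S|.-1.
Proof.
move=> pS; rewrite -(sum_neq pS) -big_split /=; apply: eq_bigr => q _.
by rewrite /odd_edge /even_edge; do 2!case: eqP.
Qed.

Lemma sum_odd_degree :
  \sum_(p in S) odd_degree p = #|S :&: A| * #|S :\: A|.
Proof.
(* Symmetrising removes the colours: [odd_edge p q + odd_edge q p] is 1 across the cut and 0 inside
   either clique. *)
apply/eqP; rewrite -(eqn_pmul2l (m := 2)) // mul2n -addnn.
rewrite /odd_degree [X in _ + X == _]exchange_big -big_split /=.
have -> : \sum_(p in S) (\sum_(q in S) odd_edge p q + \sum_(q in S) odd_edge q p) =
  \sum_(p in S) \sum_(q in S) ((p \in A) * (q \notin A) + (p \notin A) * (q \in A)).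
  apply: eq_bigr => p pS; rewrite -big_split /=; apply: eq_bigr => q qS.
  rewrite /odd_edge (eq_sym q p) (g_sym q p).
  case: (eqVneq p q) => [->|npq] /=; first by case: (q \in A).
  move: (g_in pS qS npq) (g_out pS qS npq).
  by case: (p \in A) (q \in A) (g p q) => [] [] [] // H1 H2;
    (move: (H1 isT isT) || move: (H2 isT isT)).
under eq_bigr do rewrite big_split.
rewrite big_split /= -!big_distrlr /=.
have card b : \sum_(p in S) ((p \in A) == b : nat) = #|if b then S :&: A else S :\: A|.
  rewrite -big_mkcondr sum1_card; apply: eq_card => p.
  by rewrite unfold_in; case: b; rewrite !inE; case: (p \in A); rewrite ?andbT ?andbF.
move: (card true) (card false).
under eq_bigr do rewrite eqb_id; move=> ->.
under eq_bigr do rewrite eqbF_neg; move=> ->.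
by rewrite (mulnC #|_ :\: _|) addnn mul2n.
Qed.

(** An angle at [p] is two-coloured when one arm is odd and the other even, which makes twice odd
    times even degree ordered angles at [p]. *)
Lemma triple_count_mixed :
  triple_count (fun p q r => distinct3 p q r && ~~ mono3 p q r) =
  3 * \sum_(p in S) odd_degree p * even_degree p.
Proof.
pose mix p q r := distinct3 p q r && (g p q != g p r).
have mixE : triple_count mix = 2 * \sum_(p in S) odd_degree p * even_degree p.
  rewrite big_distrr /=; apply: eq_bigr => p pS.
  rewrite mul2n -addnn {2}mulnC !big_distrlr /= -big_split /=.
  apply: eq_bigr => q _; rewrite -big_split /=; apply: eq_bigr => r _.
  rewrite /mix /distinct3 /odd_edge /even_edge.
  case: (eqVneq p q) => //= _; case: (eqVneq p r) => /= _; first by rewrite !muln0.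
  case: (eqVneq q r) => [->|_] /=; first by case: (g p r); case: (p \in A).
  by case: (g p q) (g p r) (p \in A) => [] [] [].
(* A two-coloured triangle has exactly two two-coloured angles. *)
apply/eqP; rewrite -(eqn_pmul2l (m := 2)) // mulnCA -mixE.
(* The three copies of the angle count are re-indexed to have their apexes at [p], [q] and [r]. *)
rewrite -[3]/(1 + 1 + 1) !mulnDl !mul1n -{2}(triple_count_swap12 mix).
rewrite -{2}(triple_count_rot3 mix) mul2n -addnn /triple_count.
rewrite -!big_split /=; apply/eqP/eq_bigr => p _.
rewrite -!big_split /=; apply: eq_bigr => q _.
rewrite -!big_split /=; apply: eq_bigr => r _.
rewrite /mix /distinct3 /mono3 (g_sym q p) (g_sym r p) (g_sym r q).
rewrite (eq_sym q p) (eq_sym r p) (eq_sym r q).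
by case: (p == q) (p == r) (q == r) (g p q) (g p r) (g q r) => [] [] [] [] [] [].
Qed.

(** Cauchy-Schwarz, by summing [2xy <= x^2 + y^2] over all pairs. *)
Lemma sqr_sum_leq (f : V -> nat) :
  (\sum_(p in S) f p) ^ 2 <= #|S| * \sum_(p in S) f p ^ 2.
Proof.
have -> : (\sum_(p in S) f p) ^ 2 = \sum_(p in S) \sum_(q in S) f p * f q.
  by rewrite -mulnn big_distrlr.
have sqrE : #|S| * \sum_(p in S) f p ^ 2 = \sum_(p in S) \sum_(q in S) f p ^ 2.
  by rewrite exchange_big sum_nat_const.
rewrite -(leq_pmul2l (m := 2)) // [leqRHS]mul2n -addnn sqrE.
rewrite [X in _ <= X + _]exchange_big -big_split big_distrr /=.
apply: leq_sum => p _; rewrite -big_split big_distrr /=.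
by apply: leq_sum => q _; rewrite addnC nat_Cauchy.
Qed.

(** The odd degrees sum to the size of the cut, at most [t^2/4]. Their average is thus at most
    [t/4], short of the value near [t/2] that would maximise the two-coloured angles. *)
Lemma triple_count_mono : 1 < #|S| ->
  7 * #|S| ^ 3 + 32 * #|S| <=
  16 * triple_count (fun p q r => distinct3 p q r && mono3 p q r) + 36 * #|S| ^ 2.
Proof.
set M := triple_count _; set t := #|S|; move=> t_gt1.
have total : M + triple_count (fun p q r => distinct3 p q r && ~~ mono3 p q r) =
             t * t.-1 * t.-2.
  rewrite -triple_count_distinct3 /M /triple_count -big_split.
  apply: eq_bigr => p _; rewrite -big_split; apply: eq_bigr => q _.
  rewrite -big_split; apply: eq_bigr => r _ /=.
  by case: distinct3 (mono3 p q r) => [] [].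
move: total; rewrite triple_count_mixed; set D := \sum_(p in S) _ => total.
pose m := \sum_(p in S) odd_degree p.
have mD : D + \sum_(p in S) odd_degree p ^ 2 = t.-1 * m.
  rewrite big_distrr -big_split; apply: eq_bigr => p pS /=.
  by rewrite -mulnn -mulnDr addnC odd_even_degree // mulnC.
have cs := sqr_sum_leq odd_degree.
have m_le : 4 * m <= t ^ 2.
  rewrite /m sum_odd_degree /t -(cardsID A S).
  move: #|S :&: A| #|S :\: A| => a b; exact: nat_AGM2.
exact: mono_triangles_lower_bound t_gt1 mD cs total m_le.
Qed.

End Triangles.

(** * Common subsequences and levels of letters *)

Lemma size_le_lcs (T : eqType) (u s t : seq T) :
  subseq u s -> subseq u t -> size u <= lcs s t.
Proof.
case/subseqP => m /eqP sz_m -> mt.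
exact: (leq_bigmax_cond (P := fun m : (size s).-tuple bool => subseq (mask m s) t)
          (F := fun m : (size s).-tuple bool => size (mask m s)) (Tuple sz_m) mt).
Qed.

Section Levels.
Variable k : nat.
Implicit Types (p q r : {perm 'I_k}) (a b : 'I_k) (C : {set 'I_k}).

Definition precedes p a b : bool := (p^-1)%g a < (p^-1)%g b.

Lemma precedes_irr p : irreflexive (precedes p).
Proof. by move=> a; rewrite /precedes ltnn. Qed.

Lemma precedes_trans p : transitive (precedes p).
Proof. by move=> b a c; apply: ltn_trans. Qed.

Lemma precedes_total p a b : a != b -> precedes p a b || precedes p b a.
Proof.
by move=> nab; rewrite /precedes -neq_ltn (inj_eq val_inj) (inj_eq perm_inj).
Qed.

Lemma perm_word_sorted p : sorted (precedes p) (perm_word p).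
Proof.
rewrite /perm_word sorted_map.
rewrite (eq_sorted (e' := relpre val ltn)); last by move=> i j; rewrite /= /precedes !permK.
by rewrite -sorted_map val_enum_ord iota_ltn_sorted.
Qed.

Lemma perm_word_uniq p : uniq (perm_word p).
Proof. by rewrite map_inj_uniq ?enum_uniq //; apply: perm_inj. Qed.

Lemma mem_perm_word p a : a \in perm_word p.
Proof. by apply/mapP; exists ((p^-1)%g a); rewrite ?mem_enum ?permKV. Qed.

(** A common subsequence is encoded by its set of letters, which determines it because no letter
    repeats. *)
Definition common p q C : bool :=
  [forall a in C, forall b in C, precedes p a b == precedes q a b].

Lemma commonP p q C :
  reflect {in C &, precedes p =2 precedes q} (common p q C).
Proof.
apply: (iffP forall_inP) => [h a b aC bC|h a aC].
  exact: eqP (forall_inP (h a aC) b bC).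
by apply/forall_inP => b bC; apply/eqP/h.
Qed.

(** Restricted to [C], both words are sorted for the order of [q], hence equal. *)
Lemma card_common p q C :
  common p q C -> #|C| <= lcs (perm_word p) (perm_word q).
Proof.
move/commonP => comC; pose u := [seq a <- perm_word p | a \in C].
have -> : #|C| = size u.
  rewrite -(card_uniqP (filter_uniq _ (perm_word_uniq p))).
  by apply: eq_card => a; rewrite mem_filter mem_perm_word andbT.
have uE : u = [seq a <- perm_word q | a \in C].
  apply: (irr_sorted_eq (@precedes_trans q) (@precedes_irr q)).
  - apply: (sub_in_sorted (P := mem C) (e := precedes p)).
    + by move=> a b aC bC; rewrite comC.
    + exact: filter_all.
    + exact: sorted_filter (@precedes_trans p) _ _ (perm_word_sorted p).
  - exact: sorted_filter (@precedes_trans q) _ _ (perm_word_sorted q).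
  - by move=> a; rewrite !mem_filter !mem_perm_word.
by apply: size_le_lcs; rewrite ?filter_subseq // uE filter_subseq.
Qed.

Definition chain_to p q a C : bool :=
  [&& common p q C, a \in C &
      [forall b in C, ~~ precedes p a b && ~~ precedes q a b]].

Definition level p q a : nat := \max_(C | chain_to p q a C) #|C|.

Lemma level_sym p q a : level p q a = level q p a.
Proof.
apply: eq_bigl => C; rewrite /chain_to; congr [&& _, _ & _].
  by apply/commonP/commonP => h x y xC yC; rewrite h.
by apply: eq_forallb_in => b _; rewrite andbC.
Qed.

Lemma level_le_lcs p q a : level p q a <= lcs (perm_word p) (perm_word q).
Proof. by apply/bigmax_leqP => C /and3P [/card_common]. Qed.

(** A longest common subsequence ending at [a] can be extended by [b]. *)
Lemma level_lt p q a b :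
  precedes p a b -> precedes q a b -> level p q a < level p q b.
Proof.
(* The singleton makes the family nonempty, so the maximum is attained. *)
move=> pab qab; have chain1 : chain_to p q a [set a].
  rewrite /chain_to set11; apply/and3P; split=> //.
    by apply/commonP => x y /set1P-> /set1P->; rewrite !precedes_irr.
  by apply/forall_inP => x /set1P->; rewrite !precedes_irr.
have [C /and3P [/commonP comC aC /forall_inP maxC] ->] :
    exists2 C, chain_to p q a C & level p q a = #|C|.
  have [|C chC levelE] := @eq_bigmax_cond _ (chain_to p q a) (fun C => #|C|).
    by apply/card_gt0P; exists [set a].
  by exists C.
have before s x : s \in [:: p; q] -> x \in C -> precedes s x b.
  rewrite !inE => sE xC; have [npa nqa] := andP (maxC x xC).
  have [->|nxa] := eqVneq x a; first by case/orP: sE => /eqP->.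
  case/orP: sE => /eqP->.
    by have := precedes_total p nxa; rewrite (negbTE npa) orbF => /precedes_trans; apply.
  by have := precedes_total q nxa; rewrite (negbTE nqa) orbF => /precedes_trans; apply.
have pC x : x \in C -> precedes p x b by apply: before; rewrite mem_head.
have qC x : x \in C -> precedes q x b by apply: before; rewrite !inE eqxx orbT.
have asym s x : precedes s x b -> precedes s b x = false.
  by move=> sxb; apply/negP => /(precedes_trans sxb); rewrite precedes_irr.
have bC : b \notin C by apply/negP => /pC; rewrite precedes_irr.
have := cardsU1 b C; rewrite bC add1n => <-.
apply: (leq_bigmax_cond (F := fun C : {set 'I_k} => #|C|)).
apply/and3P; split.
- apply/commonP => x y /setU1P [->|xC] /setU1P [->|yC].
  + by rewrite !precedes_irr.
  + by rewrite !asym ?pC ?qC.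
  + by rewrite pC ?qC.
  + exact: comC.
- exact: setU11.
- apply/forall_inP => x /setU1P [->|xC]; first by rewrite !precedes_irr.
  by rewrite !asym ?pC ?qC.
Qed.

Definition levels_le p q r a b : bool :=
  [&& level p q a <= level p q b, level p r a <= level p r b &
      level q r a <= level q r b].

(** If [a != b], equal levels force each two of the permutations to order [a] and [b] oppositely,
    which three cannot do. *)
Lemma level3_inj p q r a b :
  level p q a = level p q b -> level p r a = level p r b ->
  level q r a = level q r b -> a = b.
Proof.
move=> pq pr qr; apply/eqP; apply: contraT => nab.
have lt s s' : level s s' a = level s s' b -> precedes s a b = ~~ precedes s' a b.
  move=> eqs; have := @level_lt s s' a b; have := @level_lt s s' b a.
  rewrite eqs ltnn; have := precedes_total s nab; have := precedes_total s' nab.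
  by do 4!case: precedes => //=; move=> _ _ h h'; (move: (h isT isT) || move: (h' isT isT)).
have := lt _ _ qr; rewrite -[precedes q _ _]negbK -(lt _ _ pq) -(lt _ _ pr).
by case: precedes.
Qed.

Lemma sum_levels_le p q r l :
  lcs (perm_word p) (perm_word q) <= l -> lcs (perm_word p) (perm_word r) <= l ->
  lcs (perm_word q) (perm_word r) <= l ->
  8 * \sum_a \sum_b levels_le p q r a b <= (l.+1 * l.+2) ^ 3.
Proof.
move=> pq pr qr; pose Q := [set xy : 'I_l.+1 * 'I_l.+1 | xy.1 <= xy.2].
(* For the three pairs at hand levels are at most [l], so the default value of [inord] never
   arises. *)
pose v s s' a : 'I_l.+1 := inord (level s s' a).
have vE s s' a : lcs (perm_word s) (perm_word s') <= l -> v s s' a = level s s' a :> nat.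
  by move=> le_l; rewrite inordK // ltnS (leq_trans (level_le_lcs _ _ _)).
pose f ab := ((v p q ab.1, v p q ab.2), ((v p r ab.1, v p r ab.2), (v q r ab.1, v q r ab.2))).
have f_inj : injective f.
  move=> [a b] [c d] [] /= /(congr1 val) + /(congr1 val) + /(congr1 val) +
    /(congr1 val) + /(congr1 val) + /(congr1 val).
  rewrite /= !vE // => ac bd ac' bd' ac'' bd''.
  by rewrite (level3_inj ac ac' ac'') (level3_inj bd bd' bd'').
have le_card : \sum_a \sum_b levels_le p q r a b <= #|Q| ^ 3.
  rewrite pair_big /= -big_mkcond /= sum1_card -(card_imset _ f_inj).
  have -> : #|Q| ^ 3 = #|setX Q (setX Q Q)| by rewrite !cardsX !expnS expn0 muln1.
  apply/subset_leq_card/subsetP => _ /imsetP [[a b] ab ->].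
  by move: ab; rewrite unfold_in !inE /= !vE.
apply: (@leq_trans ((2 * #|Q|) ^ 3)); first by rewrite expnMn leq_mul2l le_card orbT.
rewrite leq_exp2r //; apply: eq_leq.
have -> : #|Q| = \sum_(x < l.+1) \sum_(y < l.+1) (x <= y).
  rewrite pair_big /= -big_mkcond /= sum1_card; apply: eq_card => xy.
  by rewrite inE unfold_in.
(* Adding the reversed relation counts each off-diagonal pair once and the diagonal twice, so
   [2 * #|Q| = (l+1)(l+2)]. *)
rewrite mul2n -addnn [X in _ + X]exchange_big -big_split /=.
transitivity (\sum_(x < l.+1) (l.+1 + 1)); last by rewrite sum_nat_const card_ord addn1.
apply: eq_bigr => x _; rewrite -big_split /=.
rewrite (eq_bigr (fun y : 'I_l.+1 => 1 + (y == x))) => [|y _]; last first.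
  by rewrite -(inj_eq val_inj) /=; case: ltngtP.
by rewrite big_split /= sum_nat_const card_ord muln1 (bigD1 x) //= eqxx big1 // => y /negbTE->.
Qed.

End Levels.

(** * Double counting of comparable triples *)

Lemma lcs_le_max_pair k (S : {set {perm 'I_k}}) p q :
  p \in S -> q \in S -> p != q ->
  lcs (perm_word p) (perm_word q) <= max_pair_lcs S.
Proof.
move=> pS qS npq; rewrite /max_pair_lcs (bigD1 p) //= leq_max; apply/orP; left.
by rewrite (bigD1 q) ?qS //= leq_maxl.
Qed.

(** A red triangle is comparable from [a] to [b], a blue one from [b] to [a]. *)
Lemma sum_triple_levels_le k (S : {set {perm 'I_k}}) (a b : 'I_k) : 1 < #|S| ->
  7 * #|S| ^ 3 + 32 * #|S| <=
  16 * (triple_count S (fun p q r => distinct3 p q r && levels_le p q r a b) +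
        triple_count S (fun p q r => distinct3 p q r && levels_le p q r b a)) +
  36 * #|S| ^ 2.
Proof.
move=> t_gt1; pose g p q := level p q a <= level p q b.
(* The weak inequality makes [a = b] the case where [A] is everything and all edges are red. *)
pose A := [set p : {perm 'I_k} | (p^-1)%g a <= (p^-1)%g b].
have g_sym : symmetric g by move=> p q; rewrite /g ![level p q _]level_sym.
have g_in : {in S &, forall p q, p != q -> p \in A -> q \in A -> g p q}.
  move=> p q _ _ _; rewrite !inE /g; have [->//|nab] := eqVneq a b.
  have le_lt (s : {perm 'I_k}) : (s^-1)%g a <= (s^-1)%g b -> precedes s a b.
    by rewrite leq_eqVlt (inj_eq val_inj) (inj_eq perm_inj) (negbTE nab).
  by move=> /le_lt pab /le_lt qab; apply: ltnW; apply: level_lt.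
have g_out : {in S &, forall p q, p != q -> p \notin A -> q \notin A -> ~~ g p q}.
  by move=> p q _ _ _; rewrite !inE -!ltnNge; apply: (@level_lt _ p q b a).
apply: leq_trans (triple_count_mono g_sym g_in g_out t_gt1) _.
rewrite leq_add2r leq_mul2l /=; rewrite /triple_count.
rewrite -big_split; apply: leq_sum => p _; rewrite -big_split; apply: leq_sum => q _.
rewrite -big_split; apply: leq_sum => r _ /=; case: distinct3 => //=.
rewrite /mono3 /levels_le /g; case: (leqP (level p q a)) => [_|/ltnW->];
  case: (leqP (level p r a)) => [_|/ltnW->];
  by case: (leqP (level q r a)) => [_|/ltnW->] //=; rewrite leq_addr.
Qed.

Lemma lcs_count k (S : {set {perm 'I_k}}) (t := #|S|) (l := max_pair_lcs S) :
  1 < t ->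
  k ^ 2 * (7 * t ^ 3 + 32 * t) <=
  4 * (t * t.-1 * t.-2) * (l.+1 * l.+2) ^ 3 + k ^ 2 * (36 * t ^ 2).
Proof.
move=> t_gt1; pose le3 (p q r : {perm 'I_k}) a b := distinct3 p q r && levels_le p q r a b.
pose N a b := triple_count S (fun p q r => le3 p q r a b).
have sumN : 8 * \sum_a \sum_b N a b <= t * t.-1 * t.-2 * (l.+1 * l.+2) ^ 3.
  rewrite -triple_count_distinct3 /triple_count big_distrl /=.
  have -> : \sum_a \sum_b N a b =
    \sum_(p in S) \sum_(q in S) \sum_(r in S) \sum_a \sum_b le3 p q r a b.
    under eq_bigr => a _ do rewrite exchange_big.
    rewrite exchange_big; apply: eq_bigr => p _ /=.
    under eq_bigr => a _ do rewrite exchange_big.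
    rewrite exchange_big; apply: eq_bigr => q _ /=.
    under eq_bigr => a _ do rewrite exchange_big.
    by rewrite exchange_big.
  rewrite big_distrr; apply: leq_sum => p pS /=.
  rewrite big_distrl big_distrr; apply: leq_sum => q qS /=.
  rewrite big_distrl big_distrr; apply: leq_sum => r rS /=.
  rewrite /le3; case: (boolP (distinct3 p q r)) => [/and3P [pq pr qr]|_] /=.
    by rewrite mul1n sum_levels_le ?lcs_le_max_pair.
  by rewrite big1 // => a _; rewrite big1.
have const c : k ^ 2 * c = \sum_(a < k) \sum_(b < k) c.
  by rewrite !sum_nat_const card_ord mulnA mulnn.
rewrite !const.
apply: (@leq_trans (\sum_a \sum_b (16 * (N a b + N b a) + 36 * t ^ 2))).
  by apply: leq_sum => a _; apply: leq_sum => b _; apply: sum_triple_levels_le.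
(* Both orientations have the same total; the resulting [16 * 2] is split as [4 * 8] to match
   [sumN]. *)
under eq_bigr => a _ do rewrite big_split -big_distrr big_split.
rewrite big_split /= leq_add2r -big_distrr big_split /= [X in _ + X]exchange_big /=.
by rewrite addnn -mul2n mulnA -[16 * 2]/(4 * 8) -!(mulnA 4) leq_mul2l sumN orbT.
Qed.

(* Passage to real numbers and sixth roots *)
From Stdlib Require Import Reals Lra.

Lemma Rpower_sixth_le (c x y : R) : (0 < c)%R -> (0 < x)%R -> (0 < y)%R ->
  (c * x ^ 2 <= y ^ 6)%R -> (Rpower c (1/6) * Rpower x (1/3) <= y)%R.
Proof.
move=> c0 x0 y0 le_y; have x2 : (0 < x ^ 2)%R by apply: pow_lt.
have -> : (Rpower c (1/6) * Rpower x (1/3) = Rpower (c * x ^ 2) (1/6))%R.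
  rewrite -Rpower_mult_distr // -(Rpower_pow 2) // Rpower_mult.
  by congr (_ * Rpower _ _)%R; rewrite /=; lra.
have -> : y = Rpower (y ^ 6) (1/6).
  by rewrite -Rpower_pow // Rpower_mult (_ : INR 6 * (1/6) = 1)%R ?Rpower_1 //=; lra.
apply: Rle_Rpower_l; first lra.
by split=> //; apply: Rmult_lt_0_compat.
Qed.

Theorem theorem7 (t k : nat) (S : {set {perm 'I_k}}) :
  (5 <= t)%N -> (0 < k)%N -> #|S| = t ->
  (Rpower (7/4 - 8 / INR t) (1/6) * Rpower (INR k) (1/3) - 2
     <= INR (max_pair_lcs S))%R.
Proof.
move=> t_ge5 k_gt0 cardS; set l := max_pair_lcs S.
have t_gt1 : 1 < #|S| by rewrite cardS; apply: leq_trans t_ge5.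
have := lcs_count t_gt1; rewrite cardS -/l => {t_gt1 cardS} count.
have tR : (5 <= INR t)%R by move/leP/le_INR: t_ge5 => /=; lra.
have kR : (0 < INR k)%R by apply/lt_0_INR/ltP.
have lR := pos_INR l.
have countR : (INR k ^ 2 * (7 * INR t ^ 3 - 36 * INR t ^ 2 + 32 * INR t) <=
    4 * (INR t * (INR t - 1) * (INR t - 2)) * ((INR l + 1) * (INR l + 2)) ^ 3)%R.
  (* Exposing two successors turns the truncated predecessors into exact real subtractions. *)
  case: t t_ge5 tR count => [|[|t]] // _ _ /leP/le_INR.
  rewrite [t.+2.-2]/= [t.+2.-1]/= !expnS !expn0 !muln1 -multE -plusE.
  rewrite !(mult_INR, plus_INR) !S_INR.
  by rewrite (_ : INR 0 = 0%R) // => h; lra.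
suff : (Rpower (7/4 - 8 / INR t) (1/6) * Rpower (INR k) (1/3) <= INR l + 2)%R by lra.
move: (INR t) (INR k) (INR l) tR kR lR countR => T K L tR kR lR countR.
(* This makes the base [7/4 - 8/T] positive, as [T >= 5 > 32/7]. *)
have invT : (/ T <= / 5)%R by apply: Rinv_le_contravar; lra.
apply: Rpower_sixth_le; try lra; rewrite /Rdiv; try lra.
have w_gt0 : (0 < 4 * (T * (T - 1) * (T - 2)))%R.
  by repeat apply: Rmult_lt_0_compat; lra.
have le_L : (((L + 1) * (L + 2)) ^ 3 <= (L + 2) ^ 6)%R.
  rewrite (_ : (L + 2) ^ 6 = ((L + 2) * (L + 2)) ^ 3)%R; last ring.
  by apply: pow_incr; split; nra.
apply: Rle_trans le_L; apply: (Rmult_le_reg_l _ _ _ w_gt0).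
apply: Rle_trans countR.
rewrite (_ : 4 * (T * (T - 1) * (T - 2)) * ((7 * / 4 - 8 * / T) * K ^ 2) =
             K ^ 2 * ((T - 1) * (T - 2) * (7 * T - 32)))%R; last by field; lra.
(* The two cubics in [T] differ by [17T^2 - 78T + 64], positive for [T >= 5]. *)
by apply: Rmult_le_compat_l; [apply: pow2_ge_0 | nra].
Qed.
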